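(* Let $m\ge3$ and let $M$ be an $m\times m$ integer matrix with nonzero determinant. Then $\mathbb Z^m=\langle x_1,\dots,x_m\rangle$ is area-undistorted in $\Gamma_M$ (i.e. $\mathrm{VolD}^2_{(\Gamma_M,\mathbb Z^m)}(n)\asymp n$) if and only if $M$ has finite order, i.e. $M^j=I$ for some $j\ge1$. In particular, for $M\in GL(m,\mathbb Z)$, $\mathbb Z^m$ is area-undistorted in $\mathbb Z^m\rtimes_M\mathbb Z$ if and only if $M$ has finite order.
   Context: For an $m\times m$ integer matrix $M=(a_{ji})$ with nonzero determinant, $\Gamma_M=\langle x_1,\dots,x_m,t\mid [x_i,x_j]=1,\ tx_it^{-1}=x_1^{a_{1i}}x_2^{a_{2i}}\cdots x_m^{a_{mi}}\ (1\le i,j\le m)\rangle$; when $\det M=\pm1$ this is $\mathbb Z^m\rtimes_M\mathbb Z$. For $H\le G$ of type $F_2$ (finitely presented), choose a $K(G,1)$ with finite $2$-skeleton containing a $K(H,1)$ subcomplex with finite $2$-skeleton, with universal cover $X$ and lift $Y\subseteq X$ of the universal cover of $K(H,1)$; the volume of a cellular $2$-chain $\sum\alpha_i\sigma_i$ is $\sum|\alpha_i|$, $FV^2_Z(z)$ is the minimal volume of a $2$-chain in $Z$ bounding the $1$-cycle $z$, and $\mathrm{VolD}^2_{(G,H)}(n)=\max\{FV^2_Y(z): z\text{ a }1\text{-cycle in }Y,\ FV^2_X(z)\le n\}$. $f\asymp g$ means $f(x)\le Cg(Cx+C)+Cx+C$ and $g(x)\le Cf(Cx+C)+Cx+C$ for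 some $C>0$. *)

(* Defs.v *)
From Stdlib Require Import ClassicalEpsilon.
From Stdlib Require List.
From HB Require Import structures.
From mathcomp Require Import all_boot all_order all_algebra.
Set Implicit Arguments. Unset Strict Implicit. Unset Printing Implicit Defensive.
Import Order.TTheory GRing.Theory Num.Theory.
Local Open Scope ring_scope.

(* Words over the generators x_1..x_m (Some i) and t (None).          *)
Definition gen (m : nat) := option 'I_m.
Definition letter (m : nat) := (gen m * bool)%type.   (* true = exponent +1 *)
Definition word (m : nat) := seq (letter m).

Definition winv m (w : word m) : word m := rev (map (fun l => (l.1, ~~ l.2)) w).

Definition pw m (g : gen m) (k : int) : word m :=
  match k with Posz n => nseq n (g, true) | Negz n => nseq n.+1 (g, false) end.

Definition comm_rel m (i j : 'I_m) : word m :=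
  [:: (Some i, true); (Some j, true); (Some i, false); (Some j, false)].

Definition conj_rel m (M : 'M[int]_m) (i : 'I_m) : word m :=
  [:: (None, true); (Some i, true); (None, false)]
    ++ winv (flatten [seq pw (Some j) (M j i) | j <- enum 'I_m]).

Definition pres_rels m (M : 'M[int]_m) : seq (word m) :=
  flatten [seq [seq comm_rel i j | j <- enum 'I_m] | i <- enum 'I_m]
  ++ [seq conj_rel M i | i <- enum 'I_m].

(* relators used as 2-cells: commutators for i < j only (same group) *)
Definition torus_rels m : seq (word m) :=
  flatten [seq [seq comm_rel i j | j <- [seq j <- enum 'I_m | (nat_of_ord i < nat_of_ord j)%N]] | i <- enum 'I_m].
Definition cell_rels m (M : 'M[int]_m) : seq (word m) :=
  torus_rels m ++ [seq conj_rel M i | i <- enum 'I_m].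

Inductive wequiv m (R : seq (word m)) : word m -> word m -> Prop :=
| we_refl w : wequiv R w w
| we_sym u v : wequiv R u v -> wequiv R v u
| we_trans u v w : wequiv R u v -> wequiv R v w -> wequiv R u w
| we_free u v (g : gen m) (b : bool) :
    wequiv R (u ++ [:: (g, b); (g, ~~ b)] ++ v) (u ++ v)
| we_rel u v r : r \in R -> wequiv R (u ++ r ++ v) (u ++ v).

(* group elements are equivalence classes (predicates on words) *)
Definition grp m := word m -> Prop.
Definition cls m (R : seq (word m)) (w : word m) : grp m := fun u => wequiv R w u.
Definition is_elt m (R : seq (word m)) (g : grp m) := exists w, g = cls R w.
Definition act m (R : seq (word m)) (g : grp m) (l : letter m) : grp m :=
  fun u => exists w, g w /\ wequiv R (rcons w l) u.
Definition in_H m (R : seq (word m)) (g : grp m) :=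
  exists w : word m, all (fun l => l.1 != None) w /\ g = cls R w.

(* Cellular chains of the universal cover (Cayley 2-complex).          *)
(* vertices: grp m ; edges: (g, s) from g to g s ; faces: (g, r).       *)
Definition ind (P : Prop) : int :=
  if excluded_middle_informative P then 1 else 0.

Definition edge m := (grp m * gen m)%type.
Definition face m := (grp m * word m)%type.

Definition bd1 m (R : seq (word m)) (e : edge m) (v : grp m) : int :=
  ind (v = act R e.1 (e.2, true)) - ind (v = e.1).

Fixpoint path_edges m (R : seq (word m)) (g : grp m) (w : word m)
  : seq (edge m * int) :=
  match w with
  | [::] => [::]
  | (s, true) :: w' => ((g, s), 1) :: path_edges R (act R g (s, true)) w'
  | (s, false) :: w' =>
      let h := act R g (s, false) in ((h, s), -1) :: path_edges R h w'
  end.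

Definition bd2 m (R : seq (word m)) (f : face m) (e : edge m) : int :=
  \sum_(x <- path_edges R f.1 f.2) x.2 * ind (e = x.1).

Definition supp_list (C : Type) (c : C -> int) (s : seq C) :=
  List.NoDup s /\ forall x, c x <> 0 -> List.In x s.

Definition fin_supp (C : Type) (c : C -> int) := exists s, supp_list c s.

Definition is_bd (C D : Type) (bd : C -> D -> int) (c : C -> int) (z : D -> int) :=
  exists s, supp_list c s /\ forall y, z y = \sum_(x <- s) c x * bd x y.

Definition vol_le (C : Type) (c : C -> int) (k : nat) :=
  exists s, supp_list c s /\ (\sum_(x <- s) absz (c x) <= k)%N.

(* FV_Z(z) <= k, where Z is given by its set of 2-cells F *)
Definition FV_le m (R : seq (word m)) (F : face m -> Prop) (z : edge m -> int)
  (k : nat) :=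
  exists c : face m -> int,
    (forall f, c f <> 0 -> F f) /\ fin_supp c /\ is_bd (bd2 R) c z /\ vol_le c k.

Definition X_face m (M : 'M[int]_m) (f : face m) :=
  is_elt (pres_rels M) f.1 /\ f.2 \in cell_rels M.
Definition Y_face m (M : 'M[int]_m) (f : face m) :=
  in_H (pres_rels M) f.1 /\ f.2 \in torus_rels m.
Definition Y_edge m (M : 'M[int]_m) (e : edge m) :=
  in_H (pres_rels M) e.1 /\ e.2 != None.

Definition Y_cycle m (M : 'M[int]_m) (z : edge m -> int) :=
  fin_supp z /\ (forall e, z e <> 0 -> Y_edge M e)
  /\ is_bd (bd1 (pres_rels M)) z (fun _ => 0).

Definition VolD_le m (M : 'M[int]_m) (n k : nat) :=
  forall z, Y_cycle M z -> FV_le (pres_rels M) (X_face M) z n ->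
    FV_le (pres_rels M) (Y_face M) z k.

Definition VolD_is m (M : 'M[int]_m) (n k : nat) :=
  VolD_le M n k /\ forall k', VolD_le M n k' -> (k <= k')%N.

(* VolD ≍ n, with VolD(n) possibly infinite (then VolD(n) <= b is false) *)
Definition area_undistorted m (M : 'M[int]_m) :=
  exists C : nat, (0 < C)%N /\
    (forall n, VolD_le M n (C * (C * n + C) + C * n + C)) /\
    (forall n k, VolD_is M (C * n + C) k -> (n <= C * k + C * n + C)%N).

(* Main.v *)
Require Import Defs.
From Stdlib Require Import ClassicalEpsilon FunctionalExtensionality PropExtensionality.
From Stdlib Require List Permutation.
From HB Require Import structures.
From mathcomp Require Import all_boot all_order all_algebra.
From mathcomp Require Import zify ring.
Set Implicit Arguments. Unset Strict Implicit. Unset Printing Implicit Defensive.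
Import Order.TTheory GRing.Theory Num.Theory.
Local Open Scope ring_scope.

(** If all the loops [z] of [Z^m] satisfy a linear bound, apply it to the boundary of the
   parallelogram spanned by [N M^k e_a] and [N M^k e_b]. Conjugation by [t^k] turns it into a
   square of area [N^2] plus an annulus of area [O_k(N)], while integrating [x_i dx_j] shows that
   its area in [Z^m] is at least [N^2] times a 2x2 minor of [M^k]. Letting [N] grow, the
   2x2 minors of all powers of [M] are bounded, so two powers [M^k], [M^l] with [k < l] have the
   same ones; as [M] is injective, [D = M^(l-k)] acts trivially on the exterior square,
   which for [m >= 3] forces [D = 1] or [D = -1], and in both cases [D^2 = 1].
   Conversely, if [M] has finite order, the affine action of the group on [Z^m]
   ([x_i] by translations, [t] by [M]) gives a retraction of the 2-complex [X] onto [Y];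
   up to translation only finitely many fillings of images of faces occur, so it
   multiplies areas by a bounded factor. *)

(** * Chains as weighted lists *)

Lemma ind_refl (P : Prop) : P -> ind P = 1.
Proof. by rewrite /ind; case: excluded_middle_informative. Qed.

Lemma ind_false (P : Prop) : ~ P -> ind P = 0.
Proof. by rewrite /ind; case: excluded_middle_informative. Qed.

Lemma big_In_eq (R : Type) (idx : R) (op : Monoid.law idx) (C : Type) (s : seq C) (F G : C -> R) :
  (forall x, List.In x s -> F x = G x) ->
  \big[op/idx]_(x <- s) F x = \big[op/idx]_(x <- s) G x.
Proof.
elim: s => [|a s IH] H; first by rewrite !big_nil.
by rewrite !big_cons H /=; [rewrite IH // => x hx; apply: H; right | left].
Qed.

Arguments big_In_eq [R idx op C s F] G _.

Lemma big_Permutation (R : Type) (idx : R) (op : Monoid.com_law idx) (C : Type)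
  (s1 s2 : seq C) (F : C -> R) : Permutation.Permutation s1 s2 ->
  \big[op/idx]_(x <- s1) F x = \big[op/idx]_(x <- s2) F x.
Proof.
elim=> [//|x l l' _ IH|x y l|l l' l'' _ -> _ -> //].
- by rewrite !big_cons IH.
- by rewrite !big_cons Monoid.mulmCA.
Qed.

(** Dropping the neutral terms leaves two duplicate-free lists with the same elements, hence
    permutations of each other. Sums over chains thus do not depend on the chosen support list. *)
Lemma big_support (R : Type) (idx : R) (op : Monoid.com_law idx) (C : Type)
  (s1 s2 : seq C) (F : C -> R) : List.NoDup s1 -> List.NoDup s2 ->
  (forall x, F x <> idx -> List.In x s1) -> (forall x, F x <> idx -> List.In x s2) ->
  \big[op/idx]_(x <- s1) F x = \big[op/idx]_(x <- s2) F x.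
Proof.
move=> n1 n2 h1 h2.
pose P x := if excluded_middle_informative (F x = idx) then false else true.
have hP x : P x = true <-> F x <> idx by rewrite /P; case: excluded_middle_informative.
have filt s : \big[op/idx]_(x <- s) F x = \big[op/idx]_(x <- List.filter P s) F x.
  elim: s => [//|a s IH]; rewrite big_cons /= IH; case E: (P a); rewrite ?big_cons //.
  have -> : F a = idx by move: E; rewrite /P; case: excluded_middle_informative.
  by rewrite Monoid.mul1m.
rewrite (filt s1) (filt s2); apply: big_Permutation.
apply: Permutation.NoDup_Permutation; try exact: List.NoDup_filter.
by move=> x; rewrite !List.filter_In; split=> -[hx /[dup] hp /hP hF]; split=> //; auto.
Qed.

Lemma NoDup_cover (C : Type) (s : seq C) :
  exists l, List.NoDup l /\ forall x, List.In x s -> List.In x l.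
Proof.
elim: s => [|a s [l [nl hl]]]; first by exists [::]; split=> //; constructor.
case: (excluded_middle_informative (List.In a l)) => ha.
  by exists l; split=> // x /= [<-|/hl].
exists (a :: l); split; first by constructor.
by move=> x /= [<-|/hl ?]; [left|right].
Qed.

(* A list of weighted cells stands for the chain [ev s]. *)
Definition ev (C : Type) (s : seq (C * int)) (x : C) : int :=
  \sum_(p <- s) p.2 * ind (x = p.1).

(** Repeated cells are counted separately, so this only bounds the volume of [ev s] from above:
    opposite weights on the same cell may cancel. *)
Definition mass (C : Type) (s : seq (C * int)) : nat := (\sum_(p <- s) absz p.2)%N.

Lemma ev_cat (C : Type) (s t : seq (C * int)) x : ev (s ++ t) x = ev s x + ev t x.
Proof. exact: big_cat. Qed.

Lemma ev_cons (C : Type) (c : C * int) (t : seq (C * int)) x :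
  ev (c :: t) x = c.2 * ind (x = c.1) + ev t x.
Proof. by rewrite /ev big_cons. Qed.

Lemma ev_nil (C : Type) (x : C) : ev [::] x = 0.
Proof. exact: big_nil. Qed.

Lemma mass_cat (C : Type) (s t : seq (C * int)) : mass (s ++ t) = (mass s + mass t)%N.
Proof. by rewrite /mass big_cat. Qed.

Lemma ev_supp (C : Type) (s : seq (C * int)) x : ev s x <> 0 ->
  exists p, List.In p s /\ p.1 = x.
Proof.
elim: s => [|p s IH]; first by rewrite /ev big_nil.
rewrite ev_cons; case: (excluded_middle_informative (x = p.1)) => [->|hx] h.
  by exists p; split=> //; left.
move: h; rewrite ind_false // mulr0 add0r => /IH [q [hq <-]].
by exists q; split=> //; right.
Qed.

Lemma ev_cover (C : Type) (s : seq (C * int)) : exists l, supp_list (ev s) l.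
Proof.
have [l [nl hl]] := NoDup_cover (map fst s); exists l; split=> // x hx.
have [p [hp <-]] := ev_supp hx; by apply: hl; apply: List.in_map.
Qed.

Lemma sum_ind (C : Type) (l : seq C) (a : C) (F : C -> int) : List.NoDup l -> List.In a l ->
  \sum_(x <- l) ind (x = a) * F x = F a.
Proof.
elim: l => [//|b l IH] /List.NoDup_cons_iff [hb hl] /= ha; rewrite big_cons.
case: (excluded_middle_informative (b = a)) => [e|ne].
  rewrite e ind_refl // mul1r (big_In_eq (fun _ => 0)).
    by rewrite big1 // addr0.
  by move=> x hx; rewrite ind_false ?mul0r // => ex; apply: hb; rewrite e -ex.
by rewrite ind_false // mul0r add0r IH //; case: ha.
Qed.

(** Expanding [ev s] and exchanging the sums evaluates a cochain on the weighted list itself,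
    whatever support list was chosen. *)
Lemma pairing (C : Type) (s : seq (C * int)) (l : seq C) (F : C -> int) : supp_list (ev s) l ->
  \sum_(x <- l) ev s x * F x = \sum_(p <- s) p.2 * F p.1.
Proof.
case=> nl hl; have [l' [nl' hl']] := NoDup_cover (map fst s).
have -> : \sum_(x <- l) ev s x * F x = \sum_(x <- l') ev s x * F x.
  apply: big_support => // x hx; first by apply: hl => e; apply: hx; rewrite e mul0r.
  have [p [hp <-]] : exists p, List.In p s /\ p.1 = x.
    by apply: ev_supp => e; apply: hx; rewrite e mul0r.
  by apply: hl'; apply: List.in_map.
under eq_bigr => x _ do rewrite /ev mulr_suml.
rewrite exchange_big /=; apply: big_In_eq => p hp.
under eq_bigr => x _ do rewrite -mulrA.
by rewrite -mulr_sumr sum_ind //; apply: hl'; apply: List.in_map.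
Qed.

Lemma ev_mass (C : Type) (s : seq (C * int)) (l : seq C) : List.NoDup l ->
  (\sum_(x <- l) absz (ev s x) <= mass s)%N.
Proof.
move=> nl; elim: s => [|p s IH].
  by rewrite big1 // => x _; rewrite ev_nil.
rewrite /mass big_cons -/(mass s).
apply: (@leq_trans (\sum_(x <- l) (absz (p.2 * ind (x = p.1))%R + absz (ev s x)))%N).
  by apply: leq_sum => x _; rewrite ev_cons; lia.
rewrite big_split /= leq_add //.
elim: l nl {IH} => [|b l IH] /= nl; first by rewrite big_nil.
move/List.NoDup_cons_iff: nl => [hb hl]; rewrite big_cons.
case: (excluded_middle_informative (b = p.1)) => [e|ne]; last first.
  by rewrite ind_false // mulr0 add0n IH.
rewrite ind_refl // mulr1 (big_In_eq (op := addn) (fun _ => 0%N)).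
  by rewrite big1 // addn0.
by move=> x hx; rewrite ind_false ?mulr0 // => ex; apply: hb; rewrite e -ex.
Qed.

Lemma ev_of_fun (C : Type) (c : C -> int) (s : seq C) : supp_list c s ->
  forall x, ev [seq (y, c y) | y <- s] x = c x.
Proof.
move=> [ns hs] x; rewrite /ev big_map /=.
case: (excluded_middle_informative (List.In x s)) => hx; last first.
  have -> : c x = 0 by case: (excluded_middle_informative (c x = 0)) => // h; case: hx; apply: hs.
  rewrite (big_In_eq (fun _ => 0)) ?big1 // => y hy.
  by rewrite ind_false ?mulr0 // => e; apply: hx; rewrite e.
rewrite -(sum_ind c ns hx); apply: eq_bigr => y _; rewrite mulrC; congr (_ * _).
by congr ind; apply: propositional_extensionality; split=> ->.
Qed.

(** The separate support lists hidden in [FV_le] are merged into one weighted list, which can be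
    concatenated and rescaled freely. *)
Lemma FV_leP m (R : seq (word m)) (F : face m -> Prop) z k :
  FV_le R F z k <-> exists s : seq (face m * int),
    [/\ forall p, List.In p s -> F p.1, (mass s <= k)%N &
        forall e, z e = \sum_(p <- s) p.2 * bd2 R p.1 e].
Proof.
split.
  case=> c [hF [_ [[s1 [hs1 hz]] [s2 [[n2 h2] hk]]]]].
  (* The support list may contain cells of weight zero outside [F]; they are filtered out. *)
  exists [seq (y, c y) | y <- List.filter (fun y => c y != 0) s1]; split.
  - move=> p /List.in_map_iff [y [<- /List.filter_In [_ /eqP]]]; exact: hF.
  - rewrite /mass big_map /=; apply: leq_trans hk; apply: eq_leq.
    apply: big_support => //; first by apply: List.NoDup_filter; case: hs1.
      move=> x hx; apply/List.filter_In; have hc : c x <> 0 by move=> e; apply: hx; rewrite e.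
      by split; [case: hs1 => _; apply | apply/eqP].
    by move=> x hx; apply: h2 => e; apply: hx; rewrite e.
  - move=> e; rewrite hz big_map /=; apply: big_support.
    + by case: hs1.
    + by apply: List.NoDup_filter; case: hs1.
    + by case: hs1 => _ h x hx; apply: h => e0; apply: hx; rewrite e0 mul0r.
    + move=> x hx; apply/List.filter_In; have hc : c x <> 0 by move=> e0; apply: hx; rewrite e0 mul0r.
      by split; [case: hs1 => _; apply | apply/eqP].
case=> s [hF hk hz]; exists (ev s); case: (ev_cover s) => l hl; split; last split; last split.
- by move=> f hf; have [p [hp <-]] := ev_supp hf; apply: hF.
- by exists l.
- by exists l; split=> // e; rewrite pairing // hz.
- by exists l; split=> //; apply: leq_trans hk; apply: ev_mass; case: hl.
Qed.

(** * Words and areas *)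

Lemma wequiv_cat m (R : seq (word m)) a b u v :
  wequiv R u v -> wequiv R (a ++ u ++ b) (a ++ v ++ b).
Proof.
elim=> [w|{}u {}v _|{}u {}v w _ h1 _ h2|{}u {}v g c|{}u {}v r hr].
- exact: we_refl.
- exact: we_sym.
- exact: we_trans h1 h2.
- by have := we_free R (a ++ u) (v ++ b) g c; rewrite -!catA.
- by have := we_rel (a ++ u) (v ++ b) hr; rewrite -!catA.
Qed.

Lemma wequiv_catl m (R : seq (word m)) a u v :
  wequiv R u v -> wequiv R (a ++ u) (a ++ v).
Proof. by move/(wequiv_cat a [::]); rewrite !cats0. Qed.

Lemma wequiv_catr m (R : seq (word m)) b u v :
  wequiv R u v -> wequiv R (u ++ b) (v ++ b).
Proof. exact: (@wequiv_cat _ _ [::]). Qed.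

Lemma cls_eqP m (R : seq (word m)) u v : cls R u = cls R v <-> wequiv R u v.
Proof.
split=> [e|h]; first by have : cls R v v by [apply: we_refl]; rewrite -e.
apply: functional_extensionality => w; apply: propositional_extensionality.
by split=> h'; [apply: we_trans (we_sym h) h' | apply: we_trans h h'].
Qed.

Lemma act_cls m (R : seq (word m)) w l : act R (cls R w) l = cls R (rcons w l).
Proof.
apply: functional_extensionality => u; apply: propositional_extensionality.
rewrite /act /cls -cats1; split=> [[w' [h1 h2]]|h].
  by apply: we_trans h2; rewrite -cats1; apply: wequiv_catr.
by exists w; rewrite -cats1; split=> //; apply: we_refl.
Qed.

Lemma we_freeS m (R : seq (word m)) w (g : gen m) b :
  wequiv R (rcons (rcons w (g, b)) (g, ~~ b)) w.
Proof. by have := we_free R w [::] g b; rewrite /= cats0 -!cats1 -catA. Qed.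

Lemma act_actV m (R : seq (word m)) w s b :
  act R (act R (cls R w) (s, b)) (s, ~~ b) = cls R w.
Proof. by rewrite !act_cls; apply/cls_eqP; apply: we_freeS. Qed.

Lemma path_edges_cat m (R : seq (word m)) w0 u v :
  path_edges R (cls R w0) (u ++ v) =
  path_edges R (cls R w0) u ++ path_edges R (cls R (w0 ++ u)) v.
Proof.
elim: u w0 => [|[s b] u IH] w0 /=; first by rewrite cats0.
by case: b; rewrite act_cls IH cat_rcons.
Qed.

Lemma winv_cat m (u v : word m) : winv (u ++ v) = winv v ++ winv u.
Proof. by rewrite /winv map_cat rev_cat. Qed.

Lemma winv_cons m l (u : word m) : winv (l :: u) = winv u ++ [:: (l.1, ~~ l.2)].
Proof. by rewrite /winv /= rev_cons cats1. Qed.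

Lemma size_winv m (u : word m) : size (winv u) = size u.
Proof. by rewrite /winv size_rev size_map. Qed.

Lemma winvK m : involutive (@winv m).
Proof.
move=> u; rewrite /winv map_rev revK -map_comp -[RHS]map_id.
by apply: eq_map => -[g b] /=; rewrite negbK.
Qed.

(** With [L] equal to [predT] the words range over the whole group, with [isx] over the lattice, so
    fillings in X and in Y are treated together. *)
Definition lword m (L : pred (gen m)) (w : word m) := all (fun l => L l.1) w.

Lemma lword_cat m (L : pred (gen m)) u v : lword L (u ++ v) = lword L u && lword L v.
Proof. exact: all_cat. Qed.

Lemma lword_winv m (L : pred (gen m)) u : lword L (winv u) = lword L u.
Proof. by rewrite /lword /winv all_rev all_map; apply: eq_all. Qed.

Definition lelt m (R : seq (word m)) (L : pred (gen m)) (g : grp m) :=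
  exists w, lword L w /\ g = cls R w.

(* [u] and [v] bound an area of at most [k] faces, uniformly in the base point:
   the cellular counterpart of a van Kampen diagram. *)
Definition area_le m (R R' : seq (word m)) (L : pred (gen m)) (u v : word m) (k : nat) :=
  wequiv R u v /\ forall w0, lword L w0 -> exists s : seq (face m * int),
    [/\ forall p, List.In p s -> lelt R L p.1.1 /\ p.1.2 \in R', (mass s <= k)%N &
      forall e, ev (path_edges R (cls R w0) u) e - ev (path_edges R (cls R w0) v) e
                = \sum_(p <- s) p.2 * bd2 R p.1 e].

Section Area.
Variables (m : nat) (R R' : seq (word m)) (L : pred (gen m)).
Hypothesis R'R : {subset R' <= R}.
Local Notation area_le := (area_le R R' L).

Lemma area_leq u v k k' : (k <= k')%N -> area_le u v k -> area_le u v k'.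
Proof.
move=> kk [h H]; split=> // w0 /H [s [h1 h2 h3]]; exists s; split=> //.
exact: leq_trans kk.
Qed.

Lemma area_refl u : area_le u u 0.
Proof.
split=> [|w0 _]; first exact: we_refl.
by exists [::]; split=> //; rewrite /mass ?big_nil // => e; rewrite big_nil subrr.
Qed.

Lemma area_sym u v k : area_le u v k -> area_le v u k.
Proof.
case=> h H; split=> [|w0 /H [s [h1 h2 h3]]]; first exact: we_sym.
exists [seq (p.1, - p.2) | p <- s]; split.
- by move=> p /List.in_map_iff [q [<- /h1]].
- rewrite /mass big_map /=; apply: leq_trans h2; apply: leq_sum => p _; lia.
- move=> e; rewrite big_map /= -opprB h3 -sumrN; apply: eq_bigr => p _.
  by rewrite mulNr.
Qed.

Lemma area_trans v u w k l : area_le u v k -> area_le v w l -> area_le u w (k + l).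
Proof.
move=> [h H] [h' H']; split=> [|w0 hw]; first exact: we_trans h'.
have [s [h1 h2 h3]] := H _ hw; have [s' [h1' h2' h3']] := H' _ hw.
exists (s ++ s'); split.
- by move=> p /List.in_app_iff [/h1|/h1'].
- by rewrite mass_cat leq_add.
- by move=> e; rewrite big_cat /= -h3 -h3'; ring.
Qed.

(** The prefix [a] moves the base point, which must remain an [L]-word; the suffix [b] runs through
    the same edges on both sides, because [u] and [v] end at the same vertex. *)
Lemma area_cat a b u v k : lword L a -> area_le u v k -> area_le (a ++ u ++ b) (a ++ v ++ b) k.
Proof.
move=> ha [h H]; split=> [|w0 hw]; first exact: wequiv_cat.
have [|s [h1 h2 h3]] := H (w0 ++ a); first by rewrite lword_cat hw.
exists s; split=> // e; rewrite -h3 !path_edges_cat !ev_cat.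
have -> : cls R ((w0 ++ a) ++ u) = cls R ((w0 ++ a) ++ v).
  by apply/cls_eqP; apply: wequiv_catl.
ring.
Qed.

Lemma area_catl a u v k : lword L a -> area_le u v k -> area_le (a ++ u) (a ++ v) k.
Proof. by move=> ha /(area_cat [::] ha); rewrite !cats0. Qed.

Lemma area_catr b u v k : area_le u v k -> area_le (u ++ b) (v ++ b) k.
Proof. exact: (@area_cat [::]). Qed.

(** Backtracking traverses one edge with opposite signs, hence needs no face. *)
Lemma area_free1 g b : area_le [:: (g, b); (g, ~~ b)] [::] 0.
Proof.
split=> [|w0 hw]; first exact: (@we_free _ R [::] [::]).
exists [::]; split=> //; first by rewrite /mass big_nil.
move=> e; rewrite big_nil.
have := act_actV R w0 g b.
case: b => /= H; rewrite ?H !ev_cons ev_nil /=; ring.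
Qed.

Lemma area_free a b g c : lword L a ->
  area_le (a ++ [:: (g, c), (g, ~~ c) & b]) (a ++ b) 0.
Proof. by move=> ha; apply: (@area_cat a b [:: (g, c); (g, ~~ c)] [::]) => //; apply: area_free1. Qed.

Lemma area_rel r : r \in R' -> area_le r [::] 1.
Proof.
move=> hr; split=> [|w0 hw].
  by have := @we_rel _ R [::] [::] r (R'R hr); rewrite /= cats0.
exists [:: ((cls R w0, r), 1)]; split.
- by move=> p [<-|//]; split=> //; exists w0.
- by rewrite /mass big_seq1.
- by move=> e; rewrite big_seq1 ev_nil subr0 mul1r.
Qed.

Lemma area_mulV u : lword L u -> area_le (u ++ winv u) [::] 0.
Proof.
elim/last_ind: u => [|u [g b] IH]; first by move=> _; apply: area_refl.
rewrite -cats1 lword_cat => /andP [hu _]; rewrite winv_cat /winv /= -catA /=.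
by apply: (area_trans (v := u ++ winv u) (k := 0) (l := 0)); [exact: area_free | exact: IH].
Qed.

Lemma area_Vmul u : lword L u -> area_le (winv u ++ u) [::] 0.
Proof. by move=> hu; rewrite -{2}[u]winvK; apply: area_mulV; rewrite lword_winv. Qed.

(** Insert [v v^-1] after [u^-1], replace [v] by [u], then cancel [u^-1 u]. *)
Lemma area_winv u v k : lword L u -> lword L v -> area_le u v k ->
  area_le (winv u) (winv v) k.
Proof.
move=> hu hv h; rewrite -[k]addn0.
apply: (area_trans (v := winv u ++ u ++ winv v)); last first.
  by rewrite catA; apply: (@area_catr _ _ [::]); apply: area_Vmul.
rewrite -[k]add0n; apply: (area_trans (v := winv u ++ v ++ winv v)).
  rewrite -{1}[winv u]cats0; apply: area_catl; rewrite ?lword_winv //.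
  by apply: area_sym; apply: area_mulV.
by apply: area_cat; rewrite ?lword_winv //; apply: area_sym.
Qed.

Lemma area_of_loop u v k : lword L u -> lword L v -> area_le (u ++ winv v) [::] k -> area_le u v k.
Proof.
move=> hu hv h; rewrite -[k]add0n; apply: (area_trans (v := u ++ winv v ++ v)).
  rewrite -{1}[u]cats0; apply: area_catl => //.
  by apply: area_sym; apply: area_Vmul.
by rewrite catA; apply: (@area_catr v _ [::]).
Qed.

Lemma area_loop u v k : lword L u -> lword L v -> area_le u v k -> area_le (u ++ winv v) [::] k.
Proof.
move=> hu hv h; rewrite -[k]addn0; apply: (area_trans (v := v ++ winv v)).
  exact: area_catr.
exact: area_mulV.
Qed.

End Area.

(** * Commutation in the lattice *)

Definition isx m : pred (gen m) := fun g => g != None.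

Definition vec m (w : word m) : 'cV[int]_m :=
  \col_i ((count_mem (Some i, true) w)%:Z - (count_mem (Some i, false) w)%:Z).

Definition wordv m (v : 'cV[int]_m) : word m :=
  flatten [seq pw (Some j) (v j 0) | j <- enum 'I_m].

Lemma vec_cat m (u v : word m) : vec (u ++ v) = vec u + vec v.
Proof. by apply/colP => i; rewrite !mxE !count_cat; lia. Qed.

Lemma vec_nil m : vec [::] = 0 :> 'cV_m.
Proof. by apply/colP => i; rewrite !mxE. Qed.

Lemma vec1 m (i : 'I_m) b : vec [:: (Some i, b)] = if b then delta_mx i 0 else - delta_mx i 0.
Proof.
apply/colP => j; case: b; rewrite !mxE /= !xpair_eqE /= ?andbT ?andbF;
  by rewrite (inj_eq (@Some_inj _)) eq_sym; case: (j == i).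
Qed.

Lemma vec_t m b : vec [:: (None, b)] = 0 :> 'cV_m.
Proof. by apply/colP => i; rewrite !mxE. Qed.

Lemma vec_winv m (u : word m) : vec (winv u) = - vec u.
Proof.
apply/colP => i; rewrite !mxE /winv !count_rev !count_map opprB.
by congr (_%:Z - _%:Z); apply: eq_count => -[g [|]]; rewrite /= !xpair_eqE.
Qed.

Lemma vec_flatten m (s : seq (word m)) : vec (flatten s) = \sum_(u <- s) vec u.
Proof. by elim: s => [|u s IH]; rewrite ?big_nil ?vec_nil // big_cons /= vec_cat IH. Qed.

Lemma vec_nseq m (l : letter m) n : vec (nseq n l) = vec [:: l] *+ n.
Proof.
by elim: n => [|n IH]; rewrite ?vec_nil // -[nseq _ _]/([:: l] ++ _) vec_cat IH mulrS.
Qed.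

Lemma vec_pw m (j : 'I_m) k : vec (pw (Some j) k) = k *: delta_mx j 0.
Proof.
case: k => n; rewrite /pw vec_nseq vec1.
  by rewrite -[Posz n]natz scaler_nat.
by rewrite NegzE scaleNr -[Posz n.+1]natz scaler_nat mulNrn.
Qed.

Lemma vec_wordv m (v : 'cV[int]_m) : vec (wordv v) = v.
Proof.
rewrite /wordv vec_flatten big_map big_enum /=.
under eq_bigr => j _ do rewrite vec_pw.
apply/colP => i; rewrite summxE (bigD1 i) //= big1 => [|j ji]; rewrite !mxE.
  by rewrite !eqxx mulr1 addr0.
by rewrite eq_sym (negbTE ji) mulr0.
Qed.

Lemma wordv_delta m (i : 'I_m) : wordv (delta_mx i 0) = [:: (Some i, true)].
Proof.
rewrite /wordv.
have -> : [seq pw (Some j) ((delta_mx i 0 : 'cV[int]_m) j 0) | j <- enum 'I_m] =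
          [seq if j == i then [:: (Some i, true)] else [::] | j <- enum 'I_m].
  by apply: eq_map => j; rewrite mxE eqxx andbT; case: eqP => [->|].
have H (s : seq 'I_m) : uniq s -> flatten [seq if j == i then [:: (Some i, true)] else [::] | j <- s]
   = if i \in s then [:: (Some i, true)] else [::] :> word m.
  elim: s => [//|j s IH] /= /andP [js us]; rewrite IH // inE.
  case: (eqVneq j i) => [<-|ji]; first by rewrite (negbTE js).
  by [].
by rewrite H ?enum_uniq // mem_enum.
Qed.

Lemma lword_pw m (L : pred (gen m)) g k : L g -> lword L (pw g k).
Proof. by move=> h; case: k => n; apply/allP => x /nseqP [->]. Qed.

Lemma lword_wordv m (L : pred (gen m)) v : (forall i, L (Some i)) -> lword L (wordv v).
Proof.
move=> h; apply/allP => l /flattenP [u /mapP [j _ ->]].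
exact: (allP (lword_pw (v j 0) (h j))).
Qed.

Lemma lword_sub m (L L' : pred (gen m)) w : (forall g, L g -> L' g) -> lword L w -> lword L' w.
Proof. by move=> h /allP H; apply/allP => l /H /h. Qed.

Section Torus.
Variables (m : nat) (R R' : seq (word m)) (L : pred (gen m)).
Hypothesis R'R : {subset R' <= R}.
Hypothesis torus : {subset torus_rels m <= R'}.
Hypothesis Lx : forall i, L (Some i).
Local Notation area_le := (area_le R R' L).

Lemma lword_x w : lword (@isx m) w -> lword L w.
Proof. by apply: lword_sub => -[]. Qed.

Lemma comm_rel_in (i j : 'I_m) : (i < j)%N -> comm_rel i j \in torus_rels m.
Proof.
move=> ij; apply/flattenP; exists [seq comm_rel i k | k <- enum 'I_m & (nat_of_ord i < nat_of_ord k)%N].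
  by apply/mapP; exists i; rewrite ?mem_enum.
by apply/mapP; exists j; rewrite // mem_filter ij mem_enum.
Qed.

Lemma area_comm_pos i j : area_le [:: (Some i, true); (Some j, true)] [:: (Some j, true); (Some i, true)] 1.
Proof.
have lt_case (a b : 'I_m) : (a < b)%N -> area_le [:: (Some a, true); (Some b, true)] [:: (Some b, true); (Some a, true)] 1.
  move=> ab; apply: area_of_loop => //; rewrite /= ?Lx //.
  by apply: (@area_rel _ _ _ _ R'R (comm_rel a b)); apply: torus; apply: comm_rel_in.
case: (ltngtP i j) => ij; [exact: lt_case | by apply: area_sym; apply: lt_case |].
by rewrite (ord_inj ij); apply: (area_leq (k := 0)) => //; apply: area_refl.
Qed.

(** Writing [h] for the letter [(g, b)], one has [h^-1 q = h^-1 q h h^-1 = h^-1 h q h^-1 = q h^-1],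
    where only the middle equality costs a face. *)
Lemma area_comm_inv (g : gen m) b q : L g -> L q.1 ->
  area_le [:: (g, b); q] [:: q; (g, b)] 1 -> area_le [:: (g, ~~ b); q] [:: q; (g, ~~ b)] 1.
Proof.
move=> hg hq h.
apply: (@area_trans _ _ _ _ [:: (g, ~~ b); q; (g, b); (g, ~~ b)] _ _ 0 1).
  apply: area_sym; apply: (@area_free _ _ _ _ [:: (g, ~~ b); q] [::] g b).
  by rewrite /= hg hq.
apply: (@area_trans _ _ _ _ [:: (g, ~~ b); (g, b); q; (g, ~~ b)] _ _ 1 0).
  apply: (@area_cat _ _ _ _ [:: (g, ~~ b)] [:: (g, ~~ b)] [:: q; (g, b)] [:: (g, b); q]).
    by rewrite /= hg.
  exact: area_sym.
by rewrite -{2}[b]negbK; apply: (@area_free _ _ _ _ [::] [:: q; (g, ~~ b)] g (~~ b)).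
Qed.

Lemma area_comm_letter p q : isx p.1 -> isx q.1 -> area_le [:: p; q] [:: q; p] 1.
Proof.
case: p q => [[i|//] b] [[j|//] c] _ _.
have H c' : area_le [:: (Some i, true); (Some j, c')] [:: (Some j, c'); (Some i, true)] 1.
  case: c'; first exact: area_comm_pos.
  by apply: area_sym; exact: (@area_comm_inv (Some j) true (Some i, true) (Lx j) (Lx i) (area_comm_pos j i)).
case: b; first exact: H.
exact: (@area_comm_inv (Some i) true (Some j, c) (Lx i) (Lx j) (H c)).
Qed.

Lemma area_comm_letter_word l v : isx l.1 -> lword (@isx m) v ->
  area_le (l :: v) (v ++ [:: l]) (size v).
Proof.
move=> hl; elim: v => [|p v IH] /=; first by move=> _; apply: area_refl.
move=> /andP [hp hv]; rewrite -[(size v).+1]add1n.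
apply: (area_trans (v := p :: l :: v)).
  by apply: (@area_catr _ _ _ _ v [:: l; p] [:: p; l]); apply: area_comm_letter.
apply: (@area_catl _ _ _ _ [:: p]); last exact: IH.
by case: p hp => -[i|//] b _ /=; rewrite Lx.
Qed.

(** Each letter of [u] crosses each letter of [v] once. This gives the quadratic term of the upper
    bound in X. *)
Lemma area_comm_word u v : lword (@isx m) u -> lword (@isx m) v ->
  area_le (u ++ v) (v ++ u) (size u * size v).
Proof.
move=> + hv; elim: u => [|l u IH] /=; first by move=> _; rewrite cats0; apply: area_refl.
move=> /andP [hl hu]; rewrite mulSn addnC.
apply: (area_trans (v := l :: v ++ u)).
  apply: (@area_catl _ _ _ _ [:: l]); last exact: IH.
  by case: l hl => -[i|//] b _ /=; rewrite Lx.
have := area_catr u (area_comm_letter_word hl hv); by rewrite -catA.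
Qed.

(** As the exponent sums vanish, the inverse of the first letter occurs further on: bring the first
    letter next to it, cancel, and induct on the length. *)
Lemma area_vec0 w : lword (@isx m) w -> vec w = 0 -> exists k, area_le w [::] k.
Proof.
have [n] := ubnP (size w); elim: n w => // n IH [|[[i|//] b] w] /=.
  by move=> _ _ _; exists 0%N; apply: area_refl.
rewrite ltnS => hs hw v0.
have : (Some i, ~~ b) \in w.
  rewrite -has_pred1 has_count.
  have /matrixP/(_ i 0) := v0; rewrite !mxE /= !xpair_eqE eqxx /=.
  by case: b {v0} => /=; lia.
move/splitPr => E; case: E hs hw v0 => A B hs hw v0.
have /andP [hA hB] : lword (@isx m) A && lword (@isx m) B.
  by move: hw; rewrite /lword all_cat.
have [|||k hk] := IH (A ++ B).
- by move: hs; rewrite !size_cat /=; lia.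
- by rewrite lword_cat hA.
- move: v0; rewrite -cat1s -[_ :: B]cat1s !vec_cat !vec1 => <-.
  by case: b {hw hs} => /=; rewrite [RHS]addrCA ?addNKr ?addKr.
exists (size A + k)%N.
apply: (area_trans (v := A ++ [:: (Some i, b), (Some i, ~~ b) & B])).
  have := @area_catr _ _ _ _ ((Some i, ~~ b) :: B) _ _ _ (@area_comm_letter_word (Some i, b) A isT hA).
  by rewrite /= -catA.
rewrite -[k]add0n; apply: area_trans hk; apply: area_free.
exact: lword_x.
Qed.

Lemma area_vec_eq u v : lword (@isx m) u -> lword (@isx m) v -> vec u = vec v -> exists k, area_le u v k.
Proof.
move=> hu hv e; have [||k hk] := @area_vec0 (u ++ winv v).
- by rewrite lword_cat lword_winv hu hv.
- by rewrite vec_cat vec_winv e subrr.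
by exists k; apply: area_of_loop => //; apply: lword_x.
Qed.

End Torus.

(** * The affine representation *)

Lemma conj_relE m (M : 'M[int]_m) i :
  conj_rel M i = [:: (None, true); (Some i, true); (None, false)] ++ winv (wordv (col i M)).
Proof.
rewrite /conj_rel /wordv; congr (_ ++ winv (flatten _)).
by apply: eq_map => j; rewrite mxE.
Qed.

Lemma pres_relsP m (M : 'M[int]_m) r : r \in pres_rels M ->
  (exists i j, r = comm_rel i j) \/ (exists i, r = conj_rel M i).
Proof.
rewrite mem_cat => /orP [/flattenP [s /mapP [i _ ->] /mapP [j _ ->]]|/mapP [i _ ->]].
- by left; exists i, j.
- by right; exists i.
Qed.

Lemma torus_relsP m r : r \in torus_rels m -> exists i j, r = comm_rel i j.
Proof. by move=> /flattenP [s /mapP [i _ ->] /mapP [j _ ->]]; exists i, j. Qed.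

Lemma torus_pres m (M : 'M[int]_m) : {subset torus_rels m <= pres_rels M}.
Proof.
move=> r /torus_relsP [i [j ->]]; rewrite mem_cat; apply/orP; left.
by apply/flattenP; exists [seq comm_rel i j | j <- enum 'I_m]; apply: map_f; rewrite mem_enum.
Qed.

Lemma torus_cell m (M : 'M[int]_m) : {subset torus_rels m <= cell_rels M}.
Proof. by move=> r hr; rewrite mem_cat hr. Qed.

Lemma conj_cell m (M : 'M[int]_m) i : conj_rel M i \in cell_rels M.
Proof. by rewrite mem_cat map_f ?orbT // mem_enum. Qed.

Lemma cell_pres m (M : 'M[int]_m) : {subset cell_rels M <= pres_rels M}.
Proof.
move=> r; rewrite mem_cat => /orP [/torus_pres //|h].
by rewrite mem_cat h orbT.
Qed.

Section Rep.
Variables (K : comUnitRingType) (m : nat) (M : 'M[int]_m).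
Let A : 'M[K]_m := map_mx intr M.

(* [x_i] acts on [K^m] as the translation by [e_i] and [t] as the matrix [M];
   the affine map [v |-> P v + b] is encoded as the pair [(P, b)]. *)
Definition aff_mul (p q : 'M[K]_m * 'cV[K]_m) := (p.1 *m q.1, p.1 *m q.2 + p.2).

Definition aff_letter (l : letter m) : 'M[K]_m * 'cV[K]_m :=
  match l with
  | (Some i, b) => (1%:M, if b then delta_mx i 0 else - delta_mx i 0)
  | (None, b) => (if b then A else invmx A, 0)
  end.

Definition aff (w : word m) := foldr (fun l => aff_mul (aff_letter l)) (1%:M, 0) w.

Lemma aff_mul1 p : aff_mul (1%:M, 0) p = p.
Proof. by case: p => P b; rewrite /aff_mul /= !mul1mx addr0. Qed.

Lemma aff_mulA p q r : aff_mul p (aff_mul q r) = aff_mul (aff_mul p q) r.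
Proof. by rewrite /aff_mul /= !mulmxA mulmxDr addrA mulmxA. Qed.

Lemma aff_cat u v : aff (u ++ v) = aff_mul (aff u) (aff v).
Proof. by elim: u => [|l u IH] /=; rewrite ?aff_mul1 // IH aff_mulA. Qed.

Lemma aff_rcons u l : aff (rcons u l) = aff_mul (aff u) (aff_letter l).
Proof.
rewrite -cats1 aff_cat; congr aff_mul.
by rewrite /aff /= /aff_mul /= mulmx1 mulmx0 add0r; case: aff_letter.
Qed.

Lemma aff_xword w : lword (@isx m) w -> aff w = (1%:M, map_mx intr (vec w)).
Proof.
elim: w => [_|[[i|//] b] w IH /= hw]; first by rewrite vec_nil map_mx0.
rewrite IH // /aff_mul /= !mul1mx -[_ :: w]/([:: _] ++ w) vec_cat vec1 map_mxD addrC.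
by congr (_, _ + _); case: b {hw}; rewrite ?map_mxN map_delta_mx.
Qed.

Hypothesis uA : A \in unitmx.

(** Cancelling [t] uses the invertibility of [A]; translations commute; conjugating the translation
    by [e_i] with [A] gives the translation by the [i]-th column of [A]. The ring [K] is the
    rationals when only [\det M != 0] is known, the integers when [M] has finite order. *)
Lemma aff_wequiv u v : wequiv (pres_rels M) u v -> aff u = aff v.
Proof.
elim=> [//|{}u {}v _ -> //|{}u {}v w _ -> _ -> //|{}u {}v g b|{}u {}v r hr].
- rewrite !aff_cat; congr aff_mul.
  suff -> : aff [:: (g, b); (g, ~~ b)] = (1%:M, 0) by rewrite aff_mul1.
  rewrite /aff /aff_mul /= !mulmx1 !mulmx0 add0r.
  by case: g b => [i|] [] /=; rewrite ?mul1mx ?addNr ?subrr ?mulmx0 ?addr0 ?mulmxV ?mulVmx.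
- rewrite !aff_cat; congr aff_mul.
  suff -> : aff r = (1%:M, 0) by rewrite aff_mul1.
  case: (pres_relsP hr) => [[i [j ->]]|[i ->]].
    rewrite aff_xword // -[comm_rel i j]/([:: (Some i, true)] ++ [:: (Some j, true)] ++ [:: (Some i, false)] ++ [:: (Some j, false)]).
    by rewrite !vec_cat !vec1 addrCA addNKr subrr map_mx0.
  rewrite conj_relE aff_cat (@aff_xword (winv _)) ?lword_winv ?lword_wordv // vec_winv vec_wordv.
  rewrite /aff /aff_mul /= !mulmx1 !mul1mx !mulmx0 !addr0 !add0r mulmxV // mul1mx.
  by rewrite colE map_mxN map_mxM map_delta_mx addNr.
Qed.

End Rep.

(** The lattice embeds in the group: over the rationals [A] is invertible even if [M] is not
    invertible over the integers, and the translation part of the affine action recovers [vec]. *)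
Lemma vec_wequiv m (M : 'M[int]_m) u v : \det M != 0 ->
  lword (@isx m) u -> lword (@isx m) v -> wequiv (pres_rels M) u v -> vec u = vec v.
Proof.
move=> dM hu hv /(@aff_wequiv rat) h.
have /h : (map_mx intr M : 'M[rat]_m) \in unitmx.
  by rewrite unitmxE det_map_mx unitfE intr_eq0.
rewrite !aff_xword // => -[/matrixP e]; apply/matrixP => i j.
by have := e i j; rewrite !mxE => /intr_inj.
Qed.

(** * Upper bounds in X *)

(** On the letters [x_i] this is conjugation by [t], which induces [M] on the lattice. *)
Definition subst_letter m (M : 'M[int]_m) (l : letter m) : word m :=
  match l with
  | (Some i, true) => wordv (col i M)
  | (Some i, false) => winv (wordv (col i M))
  | (None, _) => [:: l]
  end.

Definition subst m (M : 'M[int]_m) (w : word m) := flatten (map (subst_letter M) w).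

Lemma lword_subst m (M : 'M[int]_m) w : lword (@isx m) w -> lword (@isx m) (subst M w).
Proof.
elim: w => [//|[[i|//] b] w IH /= hw]; rewrite /subst /= lword_cat [lword _ (flatten _)]IH // andbT.
by case: b {hw}; rewrite ?lword_winv lword_wordv.
Qed.

Lemma vec_subst m (M : 'M[int]_m) w : lword (@isx m) w -> vec (subst M w) = M *m vec w.
Proof.
elim: w => [_|[[i|//] b] w IH /= hw]; first by rewrite vec_nil mulmx0.
rewrite -[_ :: w]/([:: _] ++ w) vec_cat vec1 mulmxDr /subst /= vec_cat -[flatten _]/(subst M w) IH //.
by congr (_ + _); case: b {hw} => /=; rewrite ?vec_winv vec_wordv colE ?mulmxN.
Qed.

Lemma lword_iter_subst m (M : 'M[int]_m) k w :
  lword (@isx m) w -> lword (@isx m) (iter k (subst M) w).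
Proof. by move=> hw; elim: k => //= k; apply: lword_subst. Qed.

Lemma vec_iter_subst m (M : 'M[int]_m) k w : lword (@isx m) w ->
  vec (iter k (subst M) w) = M ^+ k *m vec w.
Proof.
move=> hw; elim: k => [|k IH]; first by rewrite expr0 mul1mx.
by rewrite iterS vec_subst ?lword_iter_subst // IH exprS mulmxA.
Qed.

Lemma size_subst m (M : 'M[int]_m) : exists D, forall w, lword (@isx m) w ->
  (size (subst M w) <= D * size w)%N.
Proof.
exists (\sum_i size (wordv (col i M)))%N.
elim=> [//|[[i|//] b] w IH /= hw].
rewrite /subst /= size_cat mulnS leq_add //; last exact: IH.
have -> : size (if b then wordv (col i M) else winv (wordv (col i M))) = size (wordv (col i M)).
  by case: b {hw}; rewrite ?size_winv.
by rewrite (bigD1 i) //= leq_addr.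
Qed.

Section Upper.
Variables (m : nat) (M : 'M[int]_m).
Local Notation area := (area_le (pres_rels M) (cell_rels M) predT).
Local Notation t := (None : gen m, true).
Local Notation t' := (None : gen m, false).

Lemma lwordT (w : word m) : lword predT w. Proof. exact/allP. Qed.
Hint Resolve lwordT : core.

Lemma area_conj_letter l : isx l.1 -> area [:: t; l; t'] (subst_letter M l) 1.
Proof.
case: l => [[i|//] b] _.
have H : area [:: t; (Some i, true); t'] (wordv (col i M)) 1.
  apply: area_of_loop => //; rewrite -conj_relE.
  apply: area_rel; [exact: cell_pres | exact: conj_cell].
by case: b => //=; apply: (area_winv _ _ H).
Qed.

(** Free insertions of [t^-1 t] between consecutive letters leave one conjugation relator per
    letter. *)
Lemma area_conj w : lword (@isx m) w -> area ([:: t] ++ w ++ [:: t']) (subst M w) (size w).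
Proof.
elim: w => [_|l w IH /= /andP [hl hw]]; first exact: (@area_free1 _ _ _ _ None true).
rewrite -[(size w).+1]add0n; apply: (area_trans (v := [:: t; l; t'] ++ [:: t] ++ w ++ [:: t'])).
  by apply: area_sym; apply: (@area_free _ _ _ _ [:: t; l] (w ++ [:: t']) None false).
rewrite -add1n /subst /=; apply: (area_trans (v := subst_letter M l ++ [:: t] ++ w ++ [:: t'])).
  exact: (area_catr _ (area_conj_letter hl)).
by apply: area_catl => //; apply: IH.
Qed.

Lemma area_conj_iter k : exists c, forall w, lword (@isx m) w ->
  area (nseq k t ++ w ++ nseq k t') (iter k (subst M) w) (c * size w)
  /\ (size (iter k (subst M) w) <= c * size w)%N.
Proof.
have [D hD] := size_subst M.
elim: k => [|k [c IH]].
  by exists 1%N => w hw; rewrite cats0 mul1n; split=> //; apply: (area_leq (k := 0)) => //; apply: area_refl.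
(* The first [c] pays for the first [k] strips, the second for the new strip along a word of length
   at most [c * size w], and [D * c] bounds the length of the next image. *)
exists (c + c + D * c)%N => w hw; have [h1 h2] := IH w hw.
split; last first.
  rewrite iterS; apply: (leq_trans (hD _ (lword_iter_subst M k hw))).
  by rewrite !mulnDl -mulnA; apply: leq_trans (leq_addl _ _); rewrite leq_mul2l h2 orbT.
apply: (area_leq (k := (c * size w + c * size w)%N)).
  by rewrite !mulnDl leq_addr.
apply: (area_trans (v := [:: t] ++ iter k (subst M) w ++ [:: t'])).
  have -> : nseq k.+1 t ++ w ++ nseq k.+1 t' = [:: t] ++ (nseq k t ++ w ++ nseq k t') ++ [:: t'].
    have -> : nseq k.+1 t' = nseq k t' ++ [:: t'] by rewrite -[k.+1]addn1 nseqD.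
    by rewrite !catA.
  by apply: area_cat.
apply: (area_leq h2); rewrite iterS; apply: area_conj.
exact: lword_iter_subst.
Qed.

Lemma winv_nseq (l : letter m) k : winv (nseq k l) = nseq k (l.1, ~~ l.2).
Proof.
rewrite /winv map_nseq; elim: k => [//|k IH].
by rewrite [nseq _ _]/= rev_cons IH -cats1 -[[:: _]]/(nseq 1 _) -nseqD addn1.
Qed.

Definition comm_word (u v : word m) := u ++ v ++ winv u ++ winv v.

(** Conjugating by [t^k] carries the commutator of [u] and [v], filled by [n * n] squares, to the
    large one; the annulus between the two loops consists of four strips, one per side, each of area
    linear in [n] for fixed [k]. *)
Lemma area_comm_iter k : exists c, forall u v n, lword (@isx m) u -> lword (@isx m) v ->
  size u = n -> size v = n ->
  area (comm_word (iter k (subst M) u) (iter k (subst M) v)) [::] (n * n + c * n).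
Proof.
have [c hc] := area_conj_iter k; exists (4 * c)%N => u v n hu hv su sv.
have [+ _] := hc u hu; have [+ _] := hc v hv; rewrite su sv.
set U := iter k _ u; set V := iter k _ v => aV aU.
set T := nseq k t in aU aV; set T' := nseq k t' in aU aV.
have TT : area (T' ++ T) [::] 0.
  have := @area_mulV _ (pres_rels M) (cell_rels M) predT T' (lwordT _).
  by rewrite /T' winv_nseq.
have prod (a b A B : word m) : area (T ++ a ++ T') A (c * n) -> area (T ++ b ++ T') B (c * n) ->
    area (T ++ (a ++ b) ++ T') (A ++ B) (2 * c * n).
  move=> ha hb; rewrite -[X in area _ _ X]add0n.
  apply: (area_trans (v := (T ++ a) ++ (T' ++ T) ++ b ++ T')).
    have -> : T ++ (a ++ b) ++ T' = (T ++ a) ++ [::] ++ b ++ T' by rewrite !catA cats0.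
    by apply: area_cat => //; apply: area_sym.
  have -> : (2 * c * n = c * n + c * n)%N by lia.
  apply: (area_trans (v := A ++ (T ++ b ++ T'))).
    by have := area_catr (T ++ b ++ T') ha; rewrite -!catA.
  exact: area_catl.
have -> : comm_word U V = (U ++ V) ++ winv (V ++ U) by rewrite /comm_word winv_cat !catA.
apply: area_loop => //.
have -> : (n * n + 4 * c * n = 2 * c * n + (n * n + 2 * c * n))%N by lia.
apply: (area_trans (v := T ++ (u ++ v) ++ T')); first by apply: area_sym; apply: prod.
apply: (area_trans (v := T ++ (v ++ u) ++ T')); last exact: prod.
apply: area_cat => //; rewrite -{1}su -sv.
by apply: area_comm_word => //; [exact: cell_pres | exact: torus_cell].
Qed.

End Upper.

(** * Lower bounds in Y *)

Lemma pairing_ev (C : Type) (s t : seq (C * int)) (F : C -> int) :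
  (forall x, ev s x = ev t x) ->
  \sum_(p <- s) p.2 * F p.1 = \sum_(p <- t) p.2 * F p.1.
Proof.
move=> e; have [l hl] := ev_cover s; rewrite -(pairing F hl).
rewrite -(@pairing _ t l); first by apply: eq_bigr => x _; rewrite e.
by case: hl => n h; split=> // x; rewrite -e; apply: h.
Qed.

(** Discrete Stokes formula: if the chain of [t] is the boundary of [s], with [P] giving the
    boundary of each cell, then integrating [F] over [t] amounts to integrating it around the cells
    of [s]. *)
Lemma pairing_bd (C D : Type) (t : seq (C * int)) (s : seq (D * int)) (P : D -> seq (C * int))
  (F : C -> int) : (forall x, ev t x = \sum_(p <- s) p.2 * ev (P p.1) x) ->
  \sum_(q <- t) q.2 * F q.1 = \sum_(p <- s) p.2 * \sum_(q <- P p.1) q.2 * F q.1.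
Proof.
move=> h.
rewrite (@pairing_ev _ t (flatten [seq [seq (q.1, p.2 * q.2) | q <- P p.1] | p <- s])).
  rewrite big_flatten big_map; apply: eq_bigr => p _ /=.
  by rewrite big_map mulr_sumr; apply: eq_bigr => q _; rewrite mulrA.
move=> x; rewrite h /ev big_flatten big_map; apply: eq_bigr => p _ /=.
by rewrite big_map mulr_sumr; apply: eq_bigr => q _; rewrite mulrA.
Qed.

Lemma path_edges_in m (R : seq (word m)) (L : pred (gen m)) w0 w q :
  lword L w0 -> lword L w -> List.In q (path_edges R (cls R w0) w) ->
  lelt R L q.1.1 /\ L q.1.2.
Proof.
elim: w w0 => [//|[s b] w IH] w0 h0 /= /andP [hs hw]; move: hs => /= hs.
have h1 b' : lword L (rcons w0 (s, b')) by rewrite -cats1 lword_cat h0 /= hs.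
case: b => /=; rewrite act_cls => -[<- /=|].
- by split=> //; exists w0.
- exact: IH.
- by split=> //; exists (rcons w0 (s, false)).
- exact: IH.
Qed.

Lemma path_edges_bd1 m (R : seq (word m)) w0 w y :
  \sum_(q <- path_edges R (cls R w0) w) q.2 * bd1 R q.1 y
  = ind (y = cls R (w0 ++ w)) - ind (y = cls R w0).
Proof.
elim: w w0 => [|[s b] w IH] w0 /=; first by rewrite big_nil cats0 subrr.
have e := act_actV R w0 s b; rewrite -cat_rcons.
case: b e => /= e; rewrite big_cons /= /bd1 /= ?e act_cls IH; ring.
Qed.

Lemma Y_cycle_loop m (M : 'M[int]_m) w : lword (@isx m) w -> wequiv (pres_rels M) w [::] ->
  Y_cycle M (ev (path_edges (pres_rels M) (cls (pres_rels M) [::]) w)).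
Proof.
move=> hw e; have [l hl] := ev_cover (path_edges (pres_rels M) (cls (pres_rels M) [::]) w).
split; first by exists l.
split; last first.
  exists l; split=> // y; rewrite pairing // path_edges_bd1 /=.
  by rewrite ((cls_eqP _ _ _).2 e) subrr.
move=> x hx; have [q [hq <-]] := ev_supp hx.
exact: (@path_edges_in _ (pres_rels M) (@isx m) [::] w q isT hw hq).
Qed.

Section Lower.
Variables (m : nat) (i j : 'I_m).

(* The integral of the 1-form [x_i dx_j] along the path [w] issued from [p]. *)
Fixpoint int_form (p : 'cV[int]_m) (w : word m) : int :=
  match w with
  | [::] => 0
  | (Some k, true) :: w => (k == j)%:R * p i 0 + int_form (p + delta_mx k 0) w
  | (Some k, false) :: w => - ((k == j)%:R * (p - delta_mx k 0) i 0) + int_form (p - delta_mx k 0) w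
  | (None, _) :: w => int_form p w
  end.

Lemma int_form_cat p u v : int_form p (u ++ v) = int_form p u + int_form (p + vec u) v.
Proof.
elim: u p => [|[[k|] b] u IH] p /=; first by rewrite vec_nil addr0 add0r.
  rewrite -[_ :: u]/([:: _] ++ u) vec_cat vec1.
  by case: b; rewrite IH !addrA.
by rewrite IH -[_ :: u]/([:: _] ++ u) vec_cat vec_t add0r.
Qed.

(** Translating the path changes the integral only through its total displacement, so on closed
    words the base point does not matter. *)
Lemma int_form_shift p w : int_form p w = int_form 0 w + p i 0 * vec w j 0.
Proof.
elim: w p => [|[[k|] b] w IH] p /=; first by rewrite vec_nil mxE mulr0 addr0.
  rewrite -[_ :: w]/([:: _] ++ w) vec_cat vec1.
  by case: b; rewrite IH [int_form (_ + _) w in RHS]IH !mxE /= !eqxx !andbT (eq_sym k j); ring.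
by rewrite IH -[_ :: w]/([:: _] ++ w) vec_cat vec_t add0r.
Qed.

Lemma int_form_winv p w : int_form p (winv w) = - int_form (p - vec w) w.
Proof.
elim: w p => [|[[k|] b] w IH] p; first by rewrite oppr0.
  rewrite winv_cons int_form_cat IH vec_winv -[_ :: w]/([:: _] ++ w) vec_cat vec1 opprD addrA.
  rewrite (addrAC p); case: b => /=.
    by rewrite addrNK addr0 opprD [RHS]addrC.
  by rewrite !opprK addrK addr0 opprD opprK [RHS]addrC.
rewrite winv_cons int_form_cat IH vec_winv -[_ :: w]/([:: _] ++ w) vec_cat vec_t add0r /=.
by rewrite addr0.
Qed.

(** Green's formula: this is the signed area of the projection of the parallelogram to the plane of
    the coordinates [i] and [j]. *)
Lemma int_form_comm u v :
  int_form 0 (comm_word u v) = vec u i 0 * vec v j 0 - vec v i 0 * vec u j 0.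
Proof.
rewrite /comm_word !int_form_cat !int_form_winv vec_winv !add0r.
rewrite [vec u + vec v]addrC addrK subrr.
rewrite (int_form_shift (vec u) v) (int_form_shift (vec v) u); ring.
Qed.

Variable M : 'M[int]_m.
Hypothesis dM : \det M != 0.
Local Notation R := (pres_rels M).

(** [epsilon] picks some [x]-word for a vertex of the lattice; [vec_wequiv] makes the result
    independent of this choice. *)
Definition coords (g : grp m) : 'cV[int]_m :=
  vec (epsilon (inhabits [::]) (fun w => lword (@isx m) w /\ g = cls R w)).

Lemma coords_cls w : lword (@isx m) w -> coords (cls R w) = vec w.
Proof.
move=> hw; rewrite /coords.
have := epsilon_spec (inhabits [::]) (fun w' => lword (@isx m) w' /\ cls R w = cls R w').
case=> [|h1 h2]; first by exists w.
by apply: (vec_wequiv dM) => //; apply/cls_eqP.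
Qed.

Definition form (e : edge m) : int := (e.2 == Some j)%:R * coords e.1 i 0.

Lemma form_path w0 w : lword (@isx m) w0 -> lword (@isx m) w ->
  \sum_(q <- path_edges R (cls R w0) w) q.2 * form q.1 = int_form (vec w0) w.
Proof.
elim: w w0 => [|[[k|//] b] w IH] w0 h0 /=; first by rewrite big_nil.
move=> hw; have h1 b' : lword (@isx m) (rcons w0 (Some k, b')) by rewrite -cats1 lword_cat h0.
by case: b {hw} (hw) => hw; rewrite big_cons act_cls IH // -cats1 vec_cat vec1 /form /=
  (inj_eq (@Some_inj _)) ?mul1r ?mulN1r !coords_cls // ?cats1 // -cats1 vec_cat vec1.
Qed.

(** By the Stokes formula the integral is a weighted sum over the faces of a filling in Y, and each
    unit square contributes at most 1 in absolute value. *)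
Lemma FV_Y_lower w k : lword (@isx m) w ->
  FV_le R (Y_face M) (ev (path_edges R (cls R [::]) w)) k ->
  (absz (int_form 0 w) <= k)%N.
Proof.
move=> hw /FV_leP [s [hs sk hz]]; apply: leq_trans sk.
rewrite -[0](vec_nil m) -form_path //.
rewrite (pairing_bd (P := fun f : face m => path_edges R f.1 f.2) _ hz).
elim: s hs {hz} => [|p s IH] hs; first by rewrite big_nil.
rewrite big_cons /mass big_cons -/(mass s).
set S := \sum_(_ <- s) _; suff : (absz S <= mass s)%N /\ (absz (\sum_(q <- path_edges R p.1.1 p.1.2) q.2 * form q.1)%R <= 1)%N.
  by case; set T := \sum_(q <- path_edges _ _ _) _; nia.
split; first by apply: IH => q hq; apply: hs; right.
have [[w0 [h0 ->]] /torus_relsP [a [b ->]]] := hs p (or_introl erefl).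
rewrite form_path // -[comm_rel a b]/(comm_word [:: (Some a, true)] [:: (Some b, true)]).
rewrite int_form_shift int_form_comm !vec_cat !vec_winv [vec _ + _]addrC.
rewrite !vec1 !mxE /=.
(* The base-point coordinate, abstracted as [x], multiplies the displacement of a closed relator,
   which is zero. *)
set x := (_ - _ in X in _ + X * _); move: x => x; rewrite !eqxx !andbT.
by case: (i == a); case: (j == b); case: (i == b); case: (j == a);
  rewrite /= ?mulr1n ?mulr0n; lia.
Qed.

End Lower.

Lemma area_undistorted_minors m (M : 'M[int]_m) : \det M != 0 -> area_undistorted M ->
  exists B : nat, forall k i j a b,
    (absz ((M ^+ k) i a * (M ^+ k) j b - (M ^+ k) i b * (M ^+ k) j a)%R <= B)%N.
Proof.
move=> dM [C [C0 [H _]]].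
exists (C * C + C)%N => k i j a b.
have [c hc] := area_comm_iter M k.
set d := absz _.
(* The hypothesis bounds the filling in Y of a loop of area [n] by [D * n + D]. The side [N] is such
   that [N * N > D * c * N + D], so a minor [d > D] would violate this bound. Both [c] and [N]
   depend on [k], but [D] does not. *)
pose D := (C * C + C)%N.
pose N := (D * c + D + 1)%N.
have hx e : lword (@isx m) (nseq N (Some e, true)) by apply/allP => l /nseqP [->].
have [||||hw hA] := hc (nseq N (Some a, true)) (nseq N (Some b, true)) N; rewrite ?size_nseq //.
set w := comm_word _ _ in hw hA.
have lw : lword (@isx m) w by rewrite /w /comm_word !lword_cat !lword_winv !lword_iter_subst.
have [s [h1 h2 h3]] := hA [::] isT.
have := H (N * N + c * N)%N _ (Y_cycle_loop lw hw).
have F : FV_le (pres_rels M) (X_face M)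
   (ev (path_edges (pres_rels M) (cls (pres_rels M) [::]) w)) (N * N + c * N).
  apply/FV_leP; exists s; split=> //.
    by move=> p hp; have [[w' [_ hw']] hr] := h1 p hp; split=> //; exists w'.
  by move=> e; rewrite -h3 ev_nil subr0.
move=> /(_ F) /(FV_Y_lower i j dM lw).
rewrite /w int_form_comm !vec_iter_subst // !vec_nseq !vec1.
have E l e : (M ^+ k *m (delta_mx e 0 *+ N)) l 0 = (M ^+ k) l e * N%:R.
  rewrite -scaler_nat -scalemxAr mxE mxE (bigD1 e) //= big1 => [|x xe].
    by rewrite mxE !eqxx mulr1 addr0 mulrC.
  by rewrite mxE (negbTE xe) mulr0.
rewrite !E.
have -> : (M ^+ k) i a * N%:R * ((M ^+ k) j b * N%:R) - (M ^+ k) i b * N%:R * ((M ^+ k) j a * N%:R)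
   = ((M ^+ k) i a * (M ^+ k) j b - (M ^+ k) i b * (M ^+ k) j a) * (N * N)%:R.
  by rewrite natrM; ring.
rewrite abszM natz /= -/d.
rewrite -/D; case: (leqP d D) => // hd.
have dN : (D.+1 * (N * N) <= d * (N * N))%N by rewrite leq_mul2r hd orbT.
move=> h; have := leq_trans dN h.
have -> : (C * (C * (N * N + c * N) + C) + C * (N * N + c * N) + C = D * (N * N + c * N) + D)%N.
  by rewrite /D; ring.
have eN : (N * N = D * c * N + D * N + N)%N by rewrite {1}/N; ring.
rewrite mulSn mulnDr addnC -addnA leq_add2l eN mulnA -addnA leq_add2l leqNgt.
have DN : (D < N)%N by rewrite /N addn1 ltnS leq_addl.
by case/negP; apply: leq_trans DN (leq_addl _ _).
Qed.

(** * Minors of the powers of an integer matrix *)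

(** Multiplying by the adjugate replaces [X] by the nonzero scalar [\det X], which can be cancelled
    over the integers. *)
Lemma mulmxI_int m n (X : 'M[int]_m) (Y Z : 'M[int]_(m, n)) :
  \det X != 0 -> X *m Y = X *m Z -> Y = Z.
Proof.
move=> dX /(congr1 (mulmx (\adj X))); rewrite !mulmxA mul_adj_mx !mul_scalar_mx.
move=> /matrixP e; apply/matrixP => i j; have := e i j; rewrite !mxE.
exact: mulfI.
Qed.

Lemma mulIrmx_int m n (X : 'M[int]_m) (Y Z : 'M[int]_(n, m)) :
  \det X != 0 -> Y *m X = Z *m X -> Y = Z.
Proof.
move=> dX /(congr1 trmx); rewrite !trmx_mul => /mulmxI_int e.
by apply: trmx_inj; apply: e; rewrite det_tr.
Qed.

Lemma det_expr_neq0 m (M : 'M[int]_m) k : \det M != 0 -> \det (M ^+ k) != 0.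
Proof.
move=> dM; elim: k => [|k IH]; first by rewrite expr0 det1.
by rewrite exprS det_mulmx mulf_neq0.
Qed.

(** This is where dimension at least 3 enters. *)
Lemma third_ord m (i a : 'I_m) : (2 < m)%N -> exists b : 'I_m, b != i /\ b != a.
Proof.
move=> m2; have : (0 < #|~: [set i; a]|)%N.
  have := cardsC [set i; a]; rewrite card_ord cards2; case: (i != a) => /=; lia.
by case/card_gt0P => b; rewrite !inE negb_or => /andP [h1 h2]; exists b.
Qed.

Definition minor2 (K : comPzRingType) m (X : 'M[K]_m) (i j a b : 'I_m) : K :=
  X i a * X j b - X i b * X j a.

(** The bivector [e_a /\ e_b] as an alternating matrix; [X] acts on bivectors by sending [W] to
    [X W X^T], and by [minor2E] the entries of the image are 2x2 minors of [X]. *)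
Definition altmx (K : pzRingType) m (a b : 'I_m) : 'M[K]_m := delta_mx a b - delta_mx b a.

Lemma mulmx_delta_tr (K : comPzRingType) m (X Y : 'M[K]_m) a b i j :
  (X *m delta_mx a b *m Y) i j = X i a * Y b j.
Proof.
rewrite mxE (bigD1 b) //= big1 => [|x xb]; rewrite mxE.
  rewrite (bigD1 a) //= big1 => [|y ya]; rewrite mxE ?(negbTE ya) ?mulr0 //.
  by rewrite !eqxx mulr1 !addr0.
rewrite big1 ?mul0r // => y _; by rewrite mxE (negbTE xb) andbF mulr0.
Qed.

Lemma altmx_mul (K : comPzRingType) m (X Y : 'M[K]_m) a b i j :
  (X *m altmx K a b *m Y) i j = X i a * Y b j - X i b * Y a j.
Proof. by rewrite /altmx mulmxBr mulmxBl mxE [X in _ + X]mxE !mulmx_delta_tr. Qed.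

Lemma minor2E (K : comPzRingType) m (X : 'M[K]_m) i j a b :
  minor2 X i j a b = (X *m altmx K a b *m X^T) i j.
Proof. by rewrite altmx_mul !mxE. Qed.

(* An endomorphism acting trivially on the exterior square is [1] or [-1]
   as soon as the dimension is at least 3. *)
Lemma alt_stable_involution m (D : 'M[int]_m) : (2 < m)%N -> \det D != 0 ->
  (forall a b, D *m altmx int a b *m D^T = altmx int a b) -> D * D = 1.
Proof.
move=> m2 dD H.
have HI a b : D *m altmx int a b *m D^T = 1%:M *m altmx int a b *m 1%:M.
  by rewrite H mul1mx mulmx1.
have off i a : i != a -> D i a = 0.
  move=> ia; have [b [bi ba]] := third_ord i a m2.
  (* The adjugate moves [D^T] to the other side; as [b] differs from [i] and [a], the entry at [i],
     [b] then reads [D i a * \det D = 0]. *)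
  have := congr1 (mulmx^~ (\adj D)^T) (HI a b).
  rewrite /= -[X in X = _]mulmxA -trmx_mul mul_adj_mx tr_scalar_mx mulmx1 mul1mx.
  move/matrixP/(_ i b); rewrite altmx_mul -[altmx _ _ _ *m _]mul1mx mulmxA altmx_mul !mxE.
  rewrite (negbTE ia) eqxx [i == b]eq_sym (negbTE bi) [a == b]eq_sym (negbTE ba).
  rewrite !mulr0n mulr0 !mul0r subr0 subrr mulr1n => /eqP.
  by rewrite mulf_eq0 (negbTE dD) orbF => /eqP.
have diag a b : a != b -> D a a * D b b = 1.
  move=> ab; have := HI a b; move/matrixP/(_ a b); rewrite !altmx_mul !mxE.
  rewrite (off a b ab) !eqxx (negbTE ab).
  by rewrite mul0r !subr0 !mulr1.
apply/matrixP => i j; rewrite !mxE (bigD1 i) //= big1 => [|x xi]; last first.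
  by rewrite (off i x) ?mul0r // eq_sym.
rewrite addr0; case: (eqVneq i j) => [<-|ij]; last by rewrite (off i j ij) mulr0.
(* The three pairwise products of the diagonal entries at [i], [b], [c] are 1, which forces the
   square of the entry at [i] to be 1. *)
have [b [bi _]] := third_ord i i m2; have [c [ci cb]] := third_ord i b m2.
have e1 : D i i * D b b = 1 by apply: diag; rewrite eq_sym.
have e2 : D i i * D c c = 1 by apply: diag; rewrite eq_sym.
have e3 : D b b * D c c = 1 by apply: diag; rewrite eq_sym.
by rewrite -[LHS]mulr1 -e3 mulrACA e1 e2 mulr1.
Qed.

Lemma bounded_minors_finite_order m (M : 'M[int]_m) B : (2 < m)%N -> \det M != 0 ->
  (forall k i j a b, (absz (minor2 (M ^+ k) i j a b) <= B)%N) ->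
  exists j : nat, (0 < j)%N /\ M ^+ j = 1%:M.
Proof.
move=> m2 dM hB.
pose T := {ffun 'I_m * 'I_m * ('I_m * 'I_m) -> 'I_(B + B).+1}.
(* Pigeonhole: shifted by [B], the minors lie between 0 and [2 B], so each exponent gives an element
   of the finite type [T]; there is one more exponent than elements of [T]. *)
pose f (k : 'I_(#|{: T}|).+1) : T :=
  [ffun q => inord (absz (minor2 (M ^+ k) q.1.1 q.1.2 q.2.1 q.2.2 + B%:Z))].
have : ~~ injectiveb f.
  by apply/negP => /injectiveP /leq_card; rewrite card_ord ltnn.
case/injectivePn => k0 [l0 kl ef].
have ek i j a b : minor2 (M ^+ k0) i j a b = minor2 (M ^+ l0) i j a b.
  have := congr1 (fun g : T => val (g ((i, j), (a, b)))) ef.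
  have := hB k0 i j a b; have := hB l0 i j a b.
  rewrite !ffunE /=; set x := minor2 _ _ _ _ _; set y := minor2 _ _ _ _ _ => hx hy.
  rewrite !inordK; lia.
wlog lt : k0 l0 kl ek {ef} / (k0 < l0)%N.
  move=> W; case: (ltngtP k0 l0) => h; first exact: (W k0 l0).
    by apply: (W l0 k0) => //; rewrite eq_sym.
  by case/eqP: kl; apply: val_inj.
set X := M ^+ k0 in ek; pose D := M ^+ (l0 - k0).
have eD : M ^+ l0 = X * D by rewrite -exprD subnKC // ltnW.
have D2 : D * D = 1.
  (* Equality of the minors of [X] and [X D] says that [X] sends a bivector and its image under [D]
     to the same bivector; [X] and [X^T] are then cancelled. *)
  apply: alt_stable_involution => //; first exact: det_expr_neq0.
  move=> a b; have dX : \det X != 0 by apply: det_expr_neq0.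
  apply: (mulmxI_int dX); apply: (@mulIrmx_int _ _ X^T); first by rewrite det_tr.
  apply/matrixP => i j; rewrite -minor2E ek eD minor2E trmx_mul.
  by rewrite -!mulmxA.
exists ((l0 - k0) * 2)%N; split; first by rewrite muln_gt0 subn_gt0 lt.
by rewrite exprM expr2.
Qed.

(** * Retraction for matrices of finite order *)

Lemma uniform_bound (T : eqType) (s : seq T) (Q : T -> nat -> Prop) :
  (forall x k l, (k <= l)%N -> Q x k -> Q x l) -> (forall x, x \in s -> exists k, Q x k) ->
  exists K, forall x, x \in s -> Q x K.
Proof.
move=> mono; elim: s => [|a s IH] H; first by exists 0%N.
have [|K hK] := IH; first by move=> x hx; apply: H; rewrite inE hx orbT.
have [k hk] := H a (mem_head a s); exists (maxn k K) => x.
rewrite inE => /orP [/eqP ->|hx]; first exact: mono (leq_maxl _ _) hk.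
exact: mono (leq_maxr _ _) (hK x hx).
Qed.

Lemma ev_path_winv m (R : seq (word m)) w0 u y :
  ev (path_edges R (cls R w0) (winv u)) y = - ev (path_edges R (cls R (w0 ++ winv u)) u) y.
Proof.
(* With an empty set of relators, a filling of the backtracking loop has no faces at all, so its
   edge chain vanishes exactly. *)
have sub : {subset [::] <= R} by [].
have [_] := @area_Vmul m R [::] predT u (introT allP (fun _ _ => isT)).
case/(_ w0 (introT allP (fun _ _ => isT))) => s [h1 _ /(_ y)].
have -> : s = [::] by case: s h1 => // p s /(_ p (or_introl erefl)) [].
rewrite big_nil ev_nil subr0 path_edges_cat ev_cat => /eqP.
by rewrite addr_eq0 => /eqP.
Qed.

Section Finite.
Variables (m : nat) (M : 'M[int]_m) (n : nat).
Hypotheses (n_gt0 : (0 < n)%N) (Mn : M ^+ n = 1%:M).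
Local Notation R := (pres_rels M).
Local Notation A := (map_mx intr M : 'M[int]_m).
Local Notation affM := (aff int M).

Lemma mapM : A = M. Proof. by apply/matrixP => i j; rewrite mxE intz. Qed.

Lemma mulM_pred : M *m M ^+ n.-1 = 1%:M.
Proof. by rewrite -[LHS]/(M * M ^+ n.-1) -exprS prednK. Qed.

Lemma unitM : A \in unitmx.
Proof. by rewrite mapM; have [] := mulmx1_unit mulM_pred. Qed.

Lemma invmxM : invmx A = M ^+ n.-1.
Proof.
have uM := unitM; rewrite mapM in uM *.
by rewrite -[RHS]mul1mx -(mulVmx uM) -mulmxA mulM_pred mulmx1.
Qed.

(** Only finitely many linear parts occur; this is what makes the later filling bound uniform. *)
Lemma aff_lin w : exists2 a, (a < n)%N & (affM w).1 = M ^+ a.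
Proof.
have red k : exists2 a, (a < n)%N & M ^+ k = M ^+ a.
  by exists (k %% n)%N; rewrite ?ltn_pmod // (expr_mod k Mn).
elim: w => [|[[i|] b] w [a _ ea]] /=; first by exists 0%N.
  by rewrite ea mul1mx; apply: red.
rewrite ea; case: b; rewrite ?invmxM ?mapM -[_ *m _]/(_ * _ : 'M[int]_m) -?exprS -?exprD; exact: red.
Qed.

Definition aff_elt (g : grp m) := affM (epsilon (inhabits [::]) (fun w => g = cls R w)).

Lemma aff_elt_cls w : aff_elt (cls R w) = affM w.
Proof.
rewrite /aff_elt; apply: (aff_wequiv unitM); apply: we_sym; apply/cls_eqP.
by apply: (epsilon_spec (inhabits [::]) (fun w' => cls R w = cls R w')); exists w.
Qed.

(* The retraction of the Cayley graph onto that of [Z^m]: a vertex goes to the image of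
   the origin under its affine map, and an edge labelled [x_i] to a path realising
   its linear part applied to [e_i]; edges labelled [t] are collapsed. *)
Definition retract_edge (e : edge m) (y : edge m) : int :=
  match e.2 with
  | Some i => ev (path_edges R (cls R (wordv (aff_elt e.1).2))
                  (wordv ((aff_elt e.1).1 *m delta_mx i 0))) y
  | None => 0
  end.

(** The label of the image of a path under the retraction, where [P] is the linear part at the
    current vertex. *)
Fixpoint retract_word (P : 'M[int]_m) (w : word m) : word m :=
  match w with
  | [::] => [::]
  | (Some i, b) :: w =>
      (if b then wordv (P *m delta_mx i 0) else winv (wordv (P *m delta_mx i 0)))
      ++ retract_word P w
  | (None, b) :: w => retract_word (P *m (if b then A else invmx A)) w
  end.

Lemma lword_retract P w : lword (@isx m) (retract_word P w).
Proof.
elim: w P => [|[[i|] b] w IH] P //=; rewrite lword_cat IH andbT.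
by case: b; rewrite ?lword_winv lword_wordv.
Qed.

(** In particular relators, which act trivially, are sent to closed words of the lattice. *)
Lemma vec_retract P w : vec (retract_word P w) = P *m (affM w).2.
Proof.
elim: w P => [|[[i|] b] w IH] P /=; first by rewrite vec_nil mulmx0.
  rewrite vec_cat IH mul1mx mulmxDr addrC; congr (_ + _).
  by case: b; rewrite ?vec_winv vec_wordv ?mulmxN.
by rewrite IH addr0 mulmxA.
Qed.

Lemma cls_vec u v : lword (@isx m) u -> lword (@isx m) v -> vec u = vec v -> cls R u = cls R v.
Proof.
move=> hu hv e; apply/cls_eqP.
by have [k [h _]] := @area_vec_eq _ _ _ (@isx m) (@torus_pres _ M) (fun _ h => h) (fun _ => isT) u v hu hv e.
Qed.

Lemma retract_path w0 w y :
  \sum_(q <- path_edges R (cls R w0) w) q.2 * retract_edge q.1 y =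
  ev (path_edges R (cls R (wordv (affM w0).2)) (retract_word (affM w0).1 w)) y.
Proof.
elim: w w0 => [|[[i|] b] w IH] w0 /=; first by rewrite big_nil ev_nil.
  rewrite path_edges_cat ev_cat; case: b => /=; rewrite big_cons act_cls IH aff_rcons /=;
    rewrite mulmx1 /retract_edge /= aff_elt_cls ?aff_rcons /= ?mulmx1.
    rewrite mul1r; congr (_ + ev (path_edges _ _ _) _).
    by apply: cls_vec; rewrite ?lword_cat ?lword_wordv // vec_cat !vec_wordv addrC.
  set u := wordv (_ *m delta_mx i 0); rewrite ev_path_winv mulN1r.
  have e : cls R (wordv ((affM w0).1 *m - delta_mx i 0 + (affM w0).2)) =
           cls R (wordv (affM w0).2 ++ winv u).
    apply: cls_vec; rewrite ?lword_cat ?lword_winv ?lword_wordv //.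
    by rewrite vec_cat vec_winv !vec_wordv mulmxN addrC.
  by rewrite e.
case: b => /=; rewrite big_cons act_cls IH aff_rcons /= /retract_edge /= mulr0 add0r;
  by rewrite mulmx0 add0r.
Qed.

(** On the lattice the linear part is the identity and the origin is translated to the vertex
    itself. *)
Lemma retract_Y e y : Y_edge M e -> retract_edge e y = ind (y = e).
Proof.
case: e => g [i|] [[w [hw /= ->]]] //= _; rewrite /retract_edge /= aff_elt_cls aff_xword //=.
rewrite mul1mx wordv_delta /= ev_cons ev_nil addr0 mul1r; congr ind.
have -> // : cls R (wordv (map_mx intr (vec w))) = cls R w.
apply: cls_vec => //; rewrite ?lword_wordv // vec_wordv.
by apply/matrixP => a b; rewrite mxE intz.
Qed.

(** The image of a face is determined, up to its base point, by its relator and by a power of [M]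
    below [n]: the maximum over these finitely many closed words is the bound. *)
Lemma retract_face_area : exists K, forall w0 r, r \in cell_rels M ->
  area_le R (torus_rels m) (@isx m) (retract_word (affM w0).1 r) [::] K.
Proof.
pose Q (q : nat * word m) K :=
  area_le R (torus_rels m) (@isx m) (retract_word (M ^+ q.1) q.2) [::] K.
have [||K hK] := @uniform_bound _ [seq (a, r) | a <- iota 0 n, r <- cell_rels M] Q.
- by move=> q k l kl; apply: area_leq.
- move=> [a r] /allpairsP [[a' r'] /= [_ hr [-> ->]]].
  apply: area_vec0 => //; [exact: torus_pres|exact: lword_retract|].
  rewrite vec_retract; have -> : affM r' = affM [::]; last by rewrite mulmx0.
  apply: (aff_wequiv unitM).
  by have := we_rel [::] [::] (cell_pres hr); rewrite cats0.
exists K => w0 r hr; have [a an ->] := aff_lin w0.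
by apply: (hK (a, r)); apply/allpairsP; exists (a, r); rewrite mem_iota.
Qed.

Lemma finite_order_undistorted : area_undistorted M.
Proof.
have [K hK] := retract_face_area.
(* Since the constant is positive, the reverse inequality is absorbed by the linear term allowed in
   the equivalence. *)
exists K.+1; split=> //; split; last by move=> *; nia.
move=> k z [[s [ns hs]] [hY _]] /FV_leP [f [hf mf hz]].
have hs' : supp_list z s by [].
(* The retraction fixes [z], so [z] is also the sum of the retracted boundaries of the faces filling
   it in X. *)
have zy y : z y = \sum_(p <- f) p.2 * \sum_(q <- path_edges R p.1.1 p.1.2) q.2 * retract_edge q.1 y.
  have e x : ev [seq (x, z x) | x <- s] x = \sum_(p <- f) p.2 * bd2 R p.1 x.
    by rewrite (ev_of_fun hs') hz.
  rewrite -(@pairing_bd _ _ _ _ (fun p : face m => path_edges R p.1 p.2) (retract_edge^~ y) e).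
  rewrite -(ev_of_fun hs' y) /ev !big_map; apply: eq_bigr => x _ /=.
  case: (eqVneq (z x) 0) => [->|/eqP hx]; first by rewrite !mul0r.
  by rewrite (retract_Y _ (hY x hx)).
have [s' [h1 h2 h3]] : exists s' : seq (face m * int),
  [/\ forall p, List.In p s' -> Y_face M p.1, (mass s' <= K * mass f)%N & forall y,
   \sum_(p <- f) p.2 * \sum_(q <- path_edges R p.1.1 p.1.2) q.2 * retract_edge q.1 y
   = \sum_(p <- s') p.2 * bd2 R p.1 y].
  elim: f hf {mf hz zy} => [|p f IH] hf.
    by exists [::]; split=> //; rewrite ?/mass ?big_nil // => y; rewrite !big_nil.
  have [|s1 [a1 a2 a3]] := IH; first by move=> q hq; apply: hf; right.
  have [[w0 e] hr] := hf p (or_introl erefl).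
  have [|s2 [b1 b2 b3]] := (hK w0 _ hr).2 (wordv (affM w0).2); first exact: lword_wordv.
  (* The face [p] is replaced by the filling of its image in Y, scaled by the weight of [p]. *)
  exists ([seq (q.1, p.2 * q.2) | q <- s2] ++ s1); split.
  - move=> q /List.in_app_iff [/List.in_map_iff [q' [<- /b1]]|/a1] //.
  - rewrite mass_cat /mass big_cons mulnDr -/(mass f) -/(mass s1) leq_add //.
    rewrite big_map /= mulnC; under eq_bigr => q _ do rewrite abszM.
    by rewrite -big_distrr /= leq_mul2l b2 orbT.
  - move=> y; rewrite big_cons big_cat /= a3 e retract_path; congr (_ + _).
    move: (b3 y); rewrite ev_nil subr0 => ->.
    by rewrite big_map mulr_sumr; apply: eq_bigr => q _; rewrite mulrA.
apply/FV_leP; exists s'; split=> //; last by move=> y; rewrite zy.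
apply: (leq_trans h2); apply: (leq_trans (leq_mul (leqnn K) mf)); nia.
Qed.

End Finite.

Theorem mainTheorem15 (m : nat) (M : 'M[int]_m) :
  (2 < m)%N -> \det M != 0 ->
  (area_undistorted M <-> exists j : nat, (0 < j)%N /\ M ^+ j = 1%:M).
Proof.
move=> m2 dM; split=> [hu|[j [j0 hj]]]; last exact: (finite_order_undistorted j0 hj).
have [B hB] := area_undistorted_minors dM hu.
exact: (bounded_minors_finite_order (B := B)).
Qed.
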